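(* Let $\|\cdot\|$ be a norm on the real vector space $c_{00}$ of finitely supported real sequences which is permutation-invariant and multiplicative, i.e. such that (1) if $x,y \in c_{00}$ are equal up to permutation of their coordinates, then $\|x\|=\|y\|$; and (2) $\|x\otimes y\| = \|x\|\cdot\|y\|$ for all $x,y\in c_{00}$. Then there exists $p\in[1,+\infty]$ such that $\|x\|=\|x\|_p$ for every $x\in c_{00}$.
   Context: $\mathbf{N}^*=\{1,2,3,\dots\}$. $c_{00}$ is the space of finitely supported real sequences $x=(x_i)_{i\in\mathbf{N}^*}$. For $x,y\in c_{00}$, $x\otimes y$ is the double-indexed sequence $(x_iy_j)_{(i,j)\in\mathbf{N}^*\times\mathbf{N}^*}$, considered as an element of $c_{00}$ via some fixed bijection between $\mathbf{N}^*$ and $\mathbf{N}^*\times\mathbf{N}^*$ (because of permutation-invariance, the choice of bijection is irrelevant). The $\ell_p$ norms are $\|x\|_p=\left(\sum_{i\in\mathbf{N}^*}|x_i|^p\right)^{1/p}$ for $1\le p<+\infty$ and $\|x\|_\infty=\sup_{i\in\mathbf{N}^*}|x_i|$. *)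

(* Defs.v *)
From HB Require Import structures.
From mathcomp Require Import all_boot all_order all_algebra.
From mathcomp Require Import all_classical all_reals all_analysis.
From mathcomp Require Import finmap.

Set Implicit Arguments.
Unset Strict Implicit.
Unset Printing Implicit Defensive.

Import Order.TTheory GRing.Theory Num.Theory.
Import numFieldNormedType.Exports.

Local Open Scope classical_set_scope.
Local Open Scope ring_scope.

(* Sequences are indexed by nat, index i standing for the (i+1)-st coordinate. *)
Definition finitely_supported (R : realType) : {pred nat -> R} :=
  [pred x : nat -> R | `[< finite_set [set i | x i != 0] >]].
Arguments finitely_supported : clear implicits.

Record c00 (R : realType) := C00 {
  c00_val :> nat -> R;
  c00P : c00_val \in finitely_supported R }.

HB.instance Definition _ (R : realType) := [isSub for @c00_val R].
HB.instance Definition _ (R : realType) := [Choice of c00 R by <:].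

Lemma finitely_supported_submod_closed (R : realType) :
  submod_closed (finitely_supported R).
Proof.
split=> [|a x y].
  apply/asboolP; rewrite (_ : [set _ | _] = set0)//.
  by apply/seteqP; split=> i //=; rewrite eqxx.
move=> /asboolP xfin /asboolP yfin; apply/asboolP.
have /sub_finite_set : [set i | (a *: x + y) i != 0] `<=`
    [set i | x i != 0] `|` [set i | y i != 0].
  move=> i /=; have [x0|] := eqVneq (x i) 0; last by left.
  by rewrite !fctE x0 scaler0 add0r; right.
by apply; rewrite finite_setU.
Qed.

HB.instance Definition _ (R : realType) := GRing.isSubmodClosed.Build _ _
  (finitely_supported R) (@finitely_supported_submod_closed R).
HB.instance Definition _ (R : realType) :=
  [SubChoice_isSubLmodule of c00 R by <:].

Lemma tensor_subproof (R : realType) (phi : nat -> nat * nat)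
    (phi_bij : bijective phi) (x y : c00 R) :
  (fun n => x (phi n).1 * y (phi n).2) \in finitely_supported R.
Proof.
apply/asboolP; have /asboolP xfin := c00P x; have /asboolP yfin := c00P y.
have -> : [set n | x (phi n).1 * y (phi n).2 != 0] =
    phi @^-1` ([set i | x i != 0] `*` [set j | y j != 0]).
  by apply/seteqP; split=> n /=; rewrite mulf_eq0 negb_or => /andP.
apply: finite_preimage; first by move=> m n _ _; exact: bij_inj.
exact: finite_setX.
Qed.

Definition tensor (R : realType) (phi : nat -> nat * nat)
    (phi_bij : bijective phi) (x y : c00 R) : c00 R :=
  C00 (tensor_subproof phi_bij x y).

Definition is_norm (R : realType) (V : lmodType R) (N : V -> R) : Prop :=
  [/\ forall x, 0 <= N x,
      forall x, N x = 0 -> x = 0,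
      forall (a : R) x, N (a *: x) = `|a| * N x &
      forall x y, N (x + y) <= N x + N y].

Definition eq_up_to_perm (R : realType) (x y : c00 R) : Prop :=
  exists2 s : nat -> nat, bijective s & forall i, y i = x (s i).

Definition permutation_invariant (R : realType) (N : c00 R -> R) : Prop :=
  forall x y, eq_up_to_perm x y -> N x = N y.

Definition multiplicative (R : realType) (phi : nat -> nat * nat)
    (phi_bij : bijective phi) (N : c00 R -> R) : Prop :=
  forall x y, N (tensor phi_bij x y) = N x * N y.

(* Only used for 1 <= p; the value at p = -oo is junk. *)
Definition lp_norm (R : realType) (p : \bar R) (x : c00 R) : R :=
  match p with
  | r%:E => (\sum_(i \in [set: nat]) `|x i| `^ r) `^ r^-1
  | +oo%E => sup [set `|x i| | i in [set: nat]]
  | -oo%E => 0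
  end.

Lemma lp_norm_Lnorm (R : realType) (p : \bar R) (x : c00 R) : (1 <= p)%E ->
  (lp_norm p x)%:E = Lnorm counting p (EFin \o x).
Proof.
have /asboolP xfin := c00P x; case: p => [p| |]//; rewrite ?lee_fin => p1.
  have p0 : 0 < p by exact: lt_le_trans p1.
  have supp i : i \notin [set i | x i != 0] -> `|x i| `^ p = 0.
    by rewrite notin_setE => /negP/negPn/eqP ->; rewrite normr0 powR0// gt_eqF.
  rewrite Lnorm_counting// /lp_norm -poweR_EFin; congr (_ `^ _)%E.
  rewrite nneseries_esumT; last by move=> n; exact: poweR_ge0.
  rewrite -(@fsbig_widen _ _ _ _ [set i | x i != 0])//=; last first.
    by move=> i [_ ?]; apply: supp; rewrite notin_setE.
  rewrite -fsumEFin// -esum_fset//.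
  rewrite esum_mkcond; apply: eq_esum => i _; case: ifPn => // /supp.
  by move=> /= ->.
have ae P : (\forall i \ae (counting : {measure set nat -> \bar R}), P i) <->
    forall i, P i.
  split=> [[A [_ A0 PA]] i|]; last by exact: aeW.
  apply: contrapT => Pi; have Ai : A i by exact: PA.
  have : (counting [set i] <= counting A :> \bar R)%E.
    by apply: le_measure; [exact: mem_set|exact: mem_set|move=> _ ->].
  by rewrite A0 /counting asboolT// fset_set1 finmap.cardfs1 lee_fin ler10.
have ubx : has_ubound [set `|x i| | i in [set: nat]].
  exists (\sum_(j <- fset_set [set j | x j != 0]) `|x j|) => _ [i _ <-].
  have [->|x0] := eqVneq (x i) 0; first by rewrite normr0 sumr_ge0.
  rewrite (finmap.big_fsetD1 i) ?in_fset_set ?inE//=.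
    by rewrite lerDl sumr_ge0.
  exact: mem_set.
rewrite unlock /= ifT; last first.
  apply: (@lt_le_trans _ _ (counting [set 0%N])).
    by rewrite /counting asboolT// fset_set1 finmap.cardfs1 lte_fin.
  by apply: le_measure; [exact: mem_set|exact: mem_set|].
apply/eqP; rewrite eq_le; apply/andP; split; last first.
  apply/ess_sup_inf.ess_supP/ae => i /=; rewrite lee_fin.
  by apply: ub_le_sup => //; exists i.
rewrite -ereal_sup_EFin//; last by exists `|x 0%N|, 0%N.
apply: ge_ereal_sup => _ [_ [i _ <-] <-].
by have /ae/(_ i) := @ess_sup_inf.ess_sup_ge _ _ _ counting (abse \o (EFin \o x)).
Qed.

(* Main.v *)
(* Tensoring with (1, -1) shows that N x only depends on the |x_i|; averaging
   over sign changes then shows that N decreases when coordinates are erased.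
   So n |-> N(1, ..., 1) (n ones) is monotone and multiplicative, hence equal
   to n^a with 0 <= a <= 1, and N agrees on indicators with the l_p norm M,
   p = 1/a. Splitting y into the level sets of |y| gives N y <= K M y when |y|
   takes K nonzero values, and symmetrically. The n-th tensor power of x has
   polynomially many distinct |values|, so N(x)^n <= (n+1)^k M(x)^n for all n,
   whence N x <= M x; likewise M x <= N x. *)

Require Import Defs.
From mathcomp Require Import all_boot all_order all_algebra.
From mathcomp Require Import all_classical all_reals all_analysis.
From mathcomp Require Import finmap ring lra zify.

Set Implicit Arguments.
Unset Strict Implicit.
Unset Printing Implicit Defensive.

Import Order.TTheory GRing.Theory Num.Theory.
Import Defs.

Local Open Scope ring_scope.

(** * Supports, indicators and restrictions of finitely supported sequences *)

Lemma c00_ext (R : realType) (x y : c00 R) : x =1 y -> x = y.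
Proof. by move=> xy; apply/val_inj/funext. Qed.

Lemma c00_support (R : realType) (x : c00 R) :
  exists2 s : seq nat, uniq s & forall i, (i \in s) = (x i != 0).
Proof.
have /asboolP xfin := c00P x.
exists (fset_set [set i | x i != 0]); first exact: fset_uniq.
by move=> i; rewrite in_fset_set//; apply/idP/idP => [/set_mem|/mem_set].
Qed.

Lemma indicator_subproof (R : realType) (s : seq nat) :
  (fun i => (i \in s)%:R) \in finitely_supported R.
Proof.
apply/asboolP; apply: (@sub_finite_set _ _ [set` s]) => [i /=|].
  by case: (i \in s) => //; rewrite eqxx.
exact: finite_seq.
Qed.

Definition indicator (R : realType) (s : seq nat) : c00 R :=
  C00 (indicator_subproof R s).

Lemma pointwise_subproof (R : realType) (f : nat -> R) (x : c00 R) :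
  (fun i => f i * x i) \in finitely_supported R.
Proof.
have /asboolP xfin := c00P x; apply/asboolP; apply: sub_finite_set xfin => i /=.
by rewrite mulf_eq0 negb_or => /andP[].
Qed.

Definition pointwise (R : realType) (f : nat -> R) (x : c00 R) : c00 R :=
  C00 (pointwise_subproof f x).

Definition restriction (R : realType) (P : pred nat) (x : c00 R) : c00 R :=
  pointwise (fun i => (P i)%:R) x.

(** * Multiplicative seminorms that depend only on absolute values *)

(** Common ground of the given norm and the l_p norms, so that the comparison below applies in both
    directions. *)
Record tensor_seminorm (R : realType) (phi : nat -> nat * nat)
    (phi_bij : bijective phi) (N : c00 R -> R) : Prop := TensorSeminorm {
  ts_triangle : forall x y : c00 R, N (x + y) <= N x + N y;
  ts_homogeneous : forall (a : R) (x : c00 R), N (a *: x) = `|a| * N x;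
  ts_abs : forall x y : c00 R, (forall i, `|x i| = `|y i|) -> N x = N y;
  ts_tensor : multiplicative phi_bij N }.

Lemma ts0 (R : realType) (phi : nat -> nat * nat) (phi_bij : bijective phi)
    (N : c00 R -> R) (hN : tensor_seminorm phi_bij N) : N 0 = 0.
Proof. by rewrite -(scale0r 0) (ts_homogeneous hN) normr0 mul0r. Qed.

(** [0 = N (x - x)] is at most [N x + N (- x) = 2 N x]. *)
Lemma ts_ge0 (R : realType) (phi : nat -> nat * nat) (phi_bij : bijective phi)
    (N : c00 R -> R) (hN : tensor_seminorm phi_bij N) (x : c00 R) : 0 <= N x.
Proof.
have := ts_triangle hN x (- 1 *: x).
rewrite (ts_homogeneous hN) normrN1 mul1r scaleN1r subrr (ts0 hN); lra.
Qed.

(* [restriction P x] is the average of [x] and of [x] with its signs flipped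
   off [P]. *)
Lemma ts_restriction (R : realType) (phi : nat -> nat * nat)
    (phi_bij : bijective phi) (N : c00 R -> R) (hN : tensor_seminorm phi_bij N)
    (P : pred nat) (x : c00 R) : N (restriction P x) <= N x.
Proof.
pose y := pointwise (fun i => if P i then 1 else -1) x.
have yx : N y = N x.
  apply: (ts_abs hN) => i /=.
  by case: ifP => _; rewrite ?mul1r// mulN1r normrN.
have -> : restriction P x = 2^-1 *: (x + y).
  apply: c00_ext => i.
  rewrite [RHS](_ : _ = 2^-1 * (x i + (if P i then 1 else -1) * x i))//.
  by rewrite [LHS]/=; case: (P i); rewrite /= ?mulr1n ?mulr0n; field.
rewrite (ts_homogeneous hN) ger0_norm ?invr_ge0//.
have := ts_triangle hN x y; rewrite yx; lra.
Qed.

(** * Comparison of two seminorms that agree on indicators *)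

Section comparison.
Context (R : realType) (phi : nat -> nat * nat) (phi_bij : bijective phi).
Context (N M : c00 R -> R).
Context (hN : tensor_seminorm phi_bij N) (hM : tensor_seminorm phi_bij M).
Context (NM : forall s, uniq s -> N (indicator R s) = M (indicator R s)).

(** Such an [x] has the same absolute values as [v] times the indicator of its support. *)
Lemma ts_flat_eq (v : R) (x : c00 R) :
  (forall i, x i != 0 -> `|x i| = v) -> N x = M x.
Proof.
move=> xv; have [s us sx] := c00_support x.
have E i : `|x i| = `|(v *: indicator R s) i|.
  rewrite [RHS](_ : _ = `|v * (i \in s)%:R|)// sx normrM.
  have [->|xi] := eqVneq (x i) 0; first by rewrite normr0 mulr0.
  by rewrite -(xv i xi) normr_id normr1 mulr1.
rewrite (ts_abs hN E) (ts_abs hM E).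
by rewrite (ts_homogeneous hN) (ts_homogeneous hM) NM.
Qed.

(** Induction on [V] splits off the level set of [v], a flat piece where [N] and [M] agree. Erasing
    coordinates does not increase [M], so each level costs at most [M x]. *)
Lemma ts_le_levels (V : seq R) (x : c00 R) :
  (forall i, x i != 0 -> `|x i| \in V) -> N x <= (size V)%:R * M x.
Proof.
elim: V x => [|v V IH] x xV.
  rewrite mul0r (_ : x = 0) ?(ts0 hN)//; apply: c00_ext => i.
  by have [//|/xV] := eqVneq (x i) 0.
pose P i := `|x i| == v.
have xE : x = restriction P x + restriction (predC P) x.
  apply: c00_ext => i.
  rewrite [RHS](_ : _ = (P i)%:R * x i + (~~ P i)%:R * x i)//.
  by case: (P i); rewrite /= ?mul1r ?mul0r ?addr0 ?add0r.
rewrite {1}xE (le_trans (ts_triangle hN _ _))// -natr1 mulrDl mul1r addrC lerD//.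
  apply: (@le_trans _ _ ((size V)%:R * M (restriction (predC P) x))).
    apply: IH => i /=; rewrite mulf_eq0 negb_or => /andP[].
    rewrite pnatr_eq0 eqb0 negbK => Pi xi; rewrite Pi mul1r.
    by have := xV i xi; rewrite inE -/(P i) (negbTE Pi).
  by rewrite ler_wpM2l// (ts_restriction hM).
rewrite (@ts_flat_eq v) ?(ts_restriction hM)// => i /=.
rewrite mulf_eq0 negb_or pnatr_eq0 eqb0 negbK => /andP[Pi _].
by rewrite Pi mul1r; apply/eqP.
Qed.

End comparison.

(** * Absorbing polynomial factors into large powers *)

Lemma bernoulli_le (R : realType) (h : R) (m : nat) :
  0 <= h -> 1 + m%:R * h <= (1 + h) ^+ m.
Proof.
move=> h0; elim: m => [|m IH]; first by rewrite mul0r addr0 expr0.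
rewrite exprS; apply: (@le_trans _ _ ((1 + h) * (1 + m%:R * h))).
  have m0 : 0 <= m%:R :> R by [].
  have : 0 <= m%:R * h * h by rewrite !mulr_ge0.
  rewrite -natr1; lra.
by rewrite ler_wpM2l// addr_ge0.
Qed.

Lemma le_of_expr_le (R : realType) (k : nat) (u v : R) : 0 <= v ->
  (forall n, u ^+ n.+1 <= n.+2%:R ^+ k * v ^+ n.+1) -> u <= v.
Proof.
move=> v0 uv; rewrite leNgt; apply/negP => vu.
(* If [v = 0], the hypothesis at [n = 0] already gives [u <= 0]. *)
have {}v0 : 0 < v.
  rewrite lt_neqAle v0 andbT; apply: contraTneq vu => v00.
  by have := uv 0; rewrite -v00 !expr1 mulr0 -leNgt.
pose h := u / v - 1; have h0 : 0 < h by rewrite subr_gt0 ltr_pdivlMr ?mul1r.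
have {uv} rn n : (1 + h) ^+ n.+1 <= n.+2%:R ^+ k.
  by rewrite addrC subrK expr_div_n ler_pdivrMr ?exprn_gt0.
(* Capping [h] at 1 gives [c * (m + 2) <= 1 + (m + 1) * h], to which Bernoulli applies. *)
pose c := Num.min h 1; have c0 : 0 < c by rewrite lt_min h0 ltr01.
(* Here [rn] is used at exponent [(m + 1) * (k + 1)]: Bernoulli raised to the power [k + 1] beats a
   polynomial of degree [k]. One factor [m + 2] is left bounded by a constant, against the
   Archimedean property. *)
have bound m : c ^+ k.+1 * m.+2%:R <= k.+1%:R ^+ k.
  have m0 : 0 < m.+2%:R :> R by rewrite ltr0n.
  rewrite -(ler_pM2r (exprn_gt0 k m0)) -mulrA -exprS -!exprMn.
  apply: (@le_trans _ _ (((1 + h) ^+ m.+1) ^+ k.+1)).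
    have h1 : 0 <= 1 + h by rewrite addr_ge0// ltW.
    apply: lerXn2r; rewrite ?nnegrE ?mulr_ge0 ?exprn_ge0 ?(ltW c0)//.
    apply: le_trans (_ : 1 + m.+1%:R * h <= _); last exact: bernoulli_le (ltW h0).
    have ch : c <= h by rewrite ge_min lexx.
    have c1 : c <= 1 by rewrite ge_min lexx orbT.
    have : c * m.+1%:R <= h * m.+1%:R by rewrite ler_wpM2r.
    by rewrite -[m.+2]addn1 natrD mulrDr mulr1 (mulrC h); lra.
  rewrite -exprM mulSn addSn (le_trans (rn _))//.
  rewrite -natrM; apply: lerXn2r; rewrite ?nnegrE// ler_nat.
  by rewrite !mulSn !mulnS; lia.
have ck : 0 < c ^+ k.+1 by exact: exprn_gt0.
have := archi_boundP (ltW (divr_gt0 (exprn_gt0 k (ltr0Sn R k)) ck)).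
set m := Num.bound _; rewrite ltr_pdivrMr// ltNge => /negP; apply.
apply: (le_trans _ (bound m)); rewrite mulrC ler_pM2l// ler_nat; lia.
Qed.

(** * Tensor powers and their absolute values *)

(** [n] counts tensorings, so there are [n + 1] factors. *)
Definition tensor_power (R : realType) (phi : nat -> nat * nat)
    (phi_bij : bijective phi) (x : c00 R) (n : nat) : c00 R :=
  iter n (fun y => tensor phi_bij y x) x.

Lemma ts_tensor_power (R : realType) (phi : nat -> nat * nat)
    (phi_bij : bijective phi) (N : c00 R -> R) (hN : tensor_seminorm phi_bij N)
    (x : c00 R) (n : nat) : N (tensor_power phi_bij x n) = N x ^+ n.+1.
Proof. by elim: n => [//|n IH] /=; rewrite (ts_tensor hN) IH -exprSr. Qed.

(** A nonzero coordinate is a product of [n + 1] nonzero entries of [x]; [t j] counts how often the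
    [j]-th point of [s] is used. *)
Lemma tensor_power_value (R : realType) (phi : nat -> nat * nat)
    (phi_bij : bijective phi) (x : c00 R) (s : seq nat) (n i : nat) :
  (forall i, (i \in s) = (x i != 0)) ->
  tensor_power phi_bij x n i != 0 ->
  exists2 t : 'I_(size s) -> nat, forall j, (t j <= n.+1)%N &
    `|tensor_power phi_bij x n i| = \prod_(j < size s) `|x (nth 0%N s j)| ^+ t j.
Proof.
move=> sx; have val1 m : x m != 0 ->
    `|x m| = \prod_(j < size s) `|x (nth 0%N s j)| ^+ (j == index m s :> nat).
  rewrite -sx => ms; have ims : (index m s < size s)%N by rewrite index_mem.
  rewrite (bigD1 (Ordinal ims))//= eqxx expr1 nth_index// big1 ?mulr1// => j.
  by rewrite -val_eqE/= => /negbTE ->.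
elim: n i => [|n IH] i /=.
  move=> /val1 ->; exists (fun j => nat_of_bool (j == index i s :> nat)) => //.
  by move=> j; case: eqP.
rewrite mulf_eq0 negb_or => /andP[/IH[t tn tE] /[dup] xi /val1 xE].
exists (fun j => t j + (j == index (phi i).2 s :> nat))%N.
  by move=> j; rewrite -addn1 leq_add// leq_b1.
rewrite normrM tE xE -big_split; apply: eq_bigr => j _.
by rewrite /= exprD.
Qed.

(** Each exponent ranges from 0 to [n + 1], and there is one exponent per point of the support,
    whose size [k] does not depend on [n]. *)
Lemma tensor_power_levels (R : realType) (phi : nat -> nat * nat)
    (phi_bij : bijective phi) (x : c00 R) :
  exists k, forall n, exists2 V : seq R, size V = (n.+2 ^ k)%N &
    forall i, tensor_power phi_bij x n i != 0 ->
      `|tensor_power phi_bij x n i| \in V.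
Proof.
have [s _ sx] := c00_support x; exists (size s) => n.
exists [seq \prod_(j < size s) `|x (nth 0%N s j)| ^+ t j |
          t : {ffun 'I_(size s) -> 'I_n.+2}].
  by rewrite size_map -cardE card_ffun !card_ord.
move=> i /(tensor_power_value sx)[t tn ->].
apply/mapP; exists [ffun j => inord (t j)]; first by rewrite mem_enum.
by apply: eq_bigr => j _; rewrite ffunE inordK// ltnS.
Qed.

(** The level bound for tensor powers reads [N x ^+ n.+1 <= n.+2%:R ^+ k * M x ^+ n.+1] by
    multiplicativity, and the polynomial factor drops out. *)
Lemma ts_le (R : realType) (phi : nat -> nat * nat) (phi_bij : bijective phi)
    (N M : c00 R -> R) (hN : tensor_seminorm phi_bij N)
    (hM : tensor_seminorm phi_bij M)
    (NM : forall s, uniq s -> N (indicator R s) = M (indicator R s))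
    (x : c00 R) : N x <= M x.
Proof.
have [k levels] := tensor_power_levels phi_bij x.
apply: (@le_of_expr_le _ k); first exact: (ts_ge0 hM).
move=> n; have [V sizeV xV] := levels n.
rewrite -(ts_tensor_power hN) -(ts_tensor_power hM) -natrX -sizeV.
exact: (ts_le_levels hN hM NM).
Qed.

(** * The l_p norms as multiplicative seminorms *)

(** As [r] is positive, zero entries contribute nothing, so [s] may exceed the support; [x] and
    [a *: x] can then share one list. *)
Lemma lp_norm_fin (R : realType) (r : R) (s : seq nat) (x : c00 R) :
  0 < r -> uniq s -> (forall i, x i != 0 -> i \in s) ->
  lp_norm r%:E x = (\sum_(i <- s) `|x i| `^ r) `^ r^-1.
Proof.
move=> r0 us xs; rewrite /lp_norm [in RHS]fsbig_seq//; congr (_ `^ _).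
apply/esym; apply: (fsbig_widen [set` s] setT) => // i [_ /= /negP is_].
apply/eqP.
by rewrite powR_eq0 normr_eq0 (gt_eqF r0) andbT; apply: contraNT is_ => /xs.
Qed.

Lemma lp_norm_infty (R : realType) (i : nat) (x : c00 R) :
  (forall j, `|x j| <= `|x i|) -> lp_norm +oo%E x = `|x i|.
Proof.
move=> xi; apply/eqP; rewrite eq_le /lp_norm; apply/andP; split.
  by apply: ge_sup => [|_ [j _ <-]//]; exists `|x i|, i.
apply: ub_le_sup; last by exists i.
by exists `|x i| => _ [j _ <-].
Qed.

Lemma c00_max (R : realType) (x : c00 R) : exists i, forall j, `|x j| <= `|x i|.
Proof.
have [s _ sx] := c00_support x.
suff [i xi] : exists i, forall j, j \in s -> `|x j| <= `|x i|.
  exists i => j; have [->|] := eqVneq (x j) 0; first by rewrite normr0.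
  by rewrite -sx => /xi.
elim: s {sx} => [|k s [i xi]]; first by exists 0%N.
have [ki|ik] := leP `|x k| `|x i|.
  by exists i => j; rewrite inE => /predU1P[->//|/xi].
exists k => j; rewrite inE => /predU1P[->//|/xi]/le_trans; apply; exact: ltW.
Qed.

Lemma lp_norm_triangle (R : realType) (p : \bar R) (x y : c00 R) :
  (1 <= p)%E -> lp_norm p (x + y) <= lp_norm p x + lp_norm p y.
Proof.
move=> p1; rewrite -lee_fin EFinD !lp_norm_Lnorm//.
exact: (@eminkowski _ _ R counting x y p).
Qed.

(** For finite [p] the sum over a product of supports factors; for [p = +oo] the maximum is attained
    at the pair of maximizing indices. *)
Lemma lp_norm_tensor (R : realType) (phi : nat -> nat * nat)
    (phi_bij : bijective phi) (p : \bar R) : (1 <= p)%E ->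
  multiplicative phi_bij (@lp_norm R p).
Proof.
case: p => [r|_|//] => [|x y].
  rewrite lee_fin => r1 x y; have r0 : 0 < r by exact: lt_le_trans r1.
  have [s us sx] := c00_support x; have [t ut ty] := c00_support y.
  have [psi phiK psiK] := phi_bij.
  rewrite (@lp_norm_fin _ r s x) ?(@lp_norm_fin _ r t y)//; last first.
  - by move=> i; rewrite sx.
  - by move=> i; rewrite ty.
  rewrite (@lp_norm_fin _ r [seq psi (i, j) | i <- s, j <- t])//; last first.
  - move=> i; rewrite /= mulf_eq0 negb_or -sx -ty => /andP[si ti].
    by apply/allpairsP; exists (phi i); split; rewrite // -surjective_pairing.
  - apply: allpairs_uniq => // -[i j] [i' j'] _ _ /= /(can_inj psiK).
    by case=> -> ->.
  rewrite big_allpairs_dep/= -powRM ?sumr_ge0//; congr (_ `^ _).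
  rewrite mulr_suml; apply: eq_bigr => i _; rewrite mulr_sumr.
  by apply: eq_bigr => j _; rewrite psiK normrM powRM.
have [i xi] := c00_max x; have [j yj] := c00_max y.
have [psi _ psiK] := phi_bij.
rewrite (lp_norm_infty xi) (lp_norm_infty yj) (@lp_norm_infty _ (psi (i, j))) /=.
  by rewrite psiK normrM.
by move=> m; rewrite psiK !normrM ler_pM.
Qed.

Lemma lp_norm_seminorm (R : realType) (phi : nat -> nat * nat)
    (phi_bij : bijective phi) (p : \bar R) : (1 <= p)%E ->
  tensor_seminorm phi_bij (@lp_norm R p).
Proof.
move=> p1; have abs_eq (x y : c00 R) : (forall i, `|x i| = `|y i|) ->
    lp_norm p x = lp_norm p y.
  move=> xy; rewrite /lp_norm; case: p {p1} => [r||//].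
    by congr (_ `^ _); apply: eq_fsbigr => i _; rewrite xy.
  by congr (sup _); apply/seteqP; split=> _ [i _ <-]; exists i.
split=> //; [by move=> x y; exact: lp_norm_triangle| |exact: lp_norm_tensor].
move=> a x; case: p p1 {abs_eq} => [r|_|//].
  rewrite lee_fin => r1; have r0 : 0 < r by exact: lt_le_trans r1.
  have [s us sx] := c00_support x.
  rewrite !(@lp_norm_fin _ r s)//; last 2 first.
  - by move=> i; rewrite sx.
  - by move=> i; rewrite [X in X != 0](_ : _ = a * x i)// mulf_eq0 negb_or sx
      => /andP[].
  (* Writing [|a|] as the [1/r]-th power of its [r]-th power lets it enter the sum. *)
  rewrite -[in RHS](powRr1 (normr_ge0 a)) -(mulfV (lt0r_neq0 r0)) powRrM.
  rewrite -powRM ?sumr_ge0 ?powR_ge0//; congr (_ `^ _).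
  rewrite mulr_sumr; apply: eq_bigr => i _.
  by rewrite -powRM// -normrM.
have [i xi] := c00_max x; rewrite (lp_norm_infty xi) (@lp_norm_infty _ i).
  by rewrite -normrM.
have aE j : (a *: x) j = a * x j by [].
by move=> j; rewrite !aE !normrM ler_wpM2l.
Qed.

Lemma lp_norm_indicator_fin (R : realType) (r : R) (s : seq nat) :
  0 < r -> uniq s -> lp_norm r%:E (indicator R s) = (size s)%:R `^ r^-1.
Proof.
move=> r0 us; rewrite (@lp_norm_fin _ r s)//; last first.
  by move=> i /=; case: (i \in s) => //; rewrite eqxx.
congr (_ `^ _); rewrite big_seq (eq_bigr (fun=> 1)).
  by rewrite -big_seq big_const_seq count_predT iter_addr_0.
by move=> i /= ->; rewrite normr1 powR1.
Qed.

Lemma lp_norm_indicator_infty (R : realType) (i : nat) (s : seq nat) :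
  i \in s -> lp_norm +oo%E (indicator R s) = 1.
Proof.
move=> si; rewrite (@lp_norm_infty _ i) /= ?si ?normr1// => j.
by case: (j \in s); rewrite ?normr1 ?normr0.
Qed.

(** * Consequences of permutation invariance *)

Lemma bijective_map_seq (s t : seq nat) : uniq s -> uniq t -> size s = size t ->
  exists2 f : nat -> nat, bijective f & map f s = t.
Proof.
elim: s t => [|a s IH] [|b t]//=.
  by move=> _ _ _; exists id => //; exists id.
move=> /andP[as_ us] /andP[bt ut] [st].
have [f f_bij fs] := IH t us ut st.
(* [g] transposes [f a] and [b]. Neither lies in [t], so [g \o f] still maps [s] to [t], and now [a]
   to [b]. *)
pose z := f a; pose g i := if i == z then b else if i == b then z else i.
have zt : z \notin t by rewrite -fs mem_map//; exact: bij_inj.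
have g_inv : involutive g.
  move=> i; rewrite /g; case: (eqVneq i z) => [->|iz].
    by rewrite eqxx; case: eqVneq.
  have [->|ib] := eqVneq i b; first by rewrite eqxx.
  by rewrite (negbTE iz) (negbTE ib).
exists (g \o f); first by apply: bij_comp => //; exact: inv_bij.
rewrite /= /g eqxx map_comp fs; congr (_ :: _).
rewrite -[RHS]map_id; apply/eq_in_map => i it.
by rewrite !ifN//; [apply: contraNneq bt|apply: contraNneq zt] => <-.
Qed.

(** With [d = (1, -1, 0, ...)], the tensors of [x] and [y] with [d] agree up to permutation: swap
    the two entries of [d] in every row where [x] and [y] differ, that is, where they are opposite.
    Then cancel [N d]. *)
Lemma norm_abs (R : realType) (phi : nat -> nat * nat)
    (phi_bij : bijective phi) (N : c00 R -> R) (N_norm : is_norm N)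
    (N_perm : permutation_invariant N)
    (N_mult : multiplicative phi_bij N) (x y : c00 R) :
  (forall i, `|x i| = `|y i|) -> N x = N y.
Proof.
move=> xy; have [_ N0 _ _] := N_norm; have [psi phiK psiK] := phi_bij.
have [d dE] : exists d : c00 R, forall i, d i = (i == 0%N)%:R - (i == 1%N)%:R.
  exists (indicator R [:: 0%N] - indicator R [:: 1%N]) => i.
  by rewrite -!mem_seq1.
have Nd : N d != 0.
  apply/eqP => /N0 d0; have := dE 0%N; rewrite d0 /= subr0 => /esym/eqP.
  by rewrite oner_eq0.
apply: (mulIf Nd); rewrite -!N_mult; apply: N_perm.
pose flip i := match i with 0 => 1 | 1 => 0 | _ => i end%N.
have flipK : involutive flip by case=> [|[]].
have dflip i : d (flip i) = - d i.
  by rewrite !dE; case: i => [|[|i]] /=; rewrite ?subr0 ?sub0r ?opprK ?oppr0.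
pose sw ij := if x ij.1 == y ij.1 then ij else (ij.1, flip ij.2).
have swK : involutive sw.
  by case=> i j; rewrite /sw /=; case: (boolP (x i == y i)) => /= [->//|/negbTE->];
    rewrite flipK.
exists (psi \o sw \o phi).
  apply: bij_comp; last exact: phi_bij.
  by apply: bij_comp; [exists phi|exact: inv_bij].
move=> m /=; rewrite psiK /sw; case: ifPn => [/eqP->//|/= xym].
rewrite dflip mulrN -mulNr; congr (_ * _).
have /eqP := xy (phi m).1; rewrite eqr_norm2 (negbTE xym) => /= /eqP ->.
by rewrite opprK.
Qed.

Lemma norm_seminorm (R : realType) (phi : nat -> nat * nat)
    (phi_bij : bijective phi) (N : c00 R -> R) (N_norm : is_norm N)
    (N_perm : permutation_invariant N)
    (N_mult : multiplicative phi_bij N) : tensor_seminorm phi_bij N.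
Proof.
have [_ _ NZ ND] := N_norm; split=> //.
exact: norm_abs N_norm N_perm N_mult.
Qed.

Lemma norm_indicator (R : realType) (N : c00 R -> R)
    (N_perm : permutation_invariant N) (s : seq nat) : uniq s ->
  N (indicator R s) = N (indicator R (iota 0 (size s))).
Proof.
move=> us; apply: N_perm.
have [f f_bij fs] := bijective_map_seq (iota_uniq 0 (size s)) us (size_iota _ _).
exists f => // i; rewrite /= -[in RHS]fs mem_map//; exact: bij_inj.
Qed.

(** * Monotone multiplicative functions are powers *)

(** Placing [m ^ j] between consecutive powers of 2 traps [j ln (f m)] and [j ln m] with the same
    exponent; letting [j] grow makes [ln (f m)] proportional to [ln m]. *)
Lemma monotone_multiplicative_power (R : realType) (f : nat -> R) :
  f 1%N = 1 -> f 2%N <= 2 -> {morph f : m n / (m * n)%N >-> m * n} ->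
  {homo f : m n / (m <= n)%N >-> m <= n} ->
  exists2 a, 0 <= a <= 1 & forall n, (0 < n)%N -> f n = n%:R `^ a.
Proof.
move=> f1 f2 fM f_homo.
(* A general [g] serves both [f] and the embedding of the naturals in [R]. *)
have log_bounds (g : nat -> R) m j : g 1%N = 1 ->
    {morph g : m n / (m * n)%N >-> m * n} ->
    {homo g : m n / (m <= n)%N >-> m <= n} -> (0 < m)%N ->
    (trunc_log 2 (m ^ j))%:R * ln (g 2%N) <= j%:R * ln (g m) <=
      (trunc_log 2 (m ^ j)).+1%:R * ln (g 2%N).
  move=> g1 gM g_homo m0.
  have gX k i : g (k ^ i)%N = g k ^+ i.
    by elim: i => [|i IH]; rewrite ?expn0// expnS gM IH exprS.
  have g0 k : (0 < k)%N -> 0 < g k.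
    by move=> k0; rewrite (lt_le_trans (@ltr01 R))// -g1 g_homo.
  rewrite !mulr_natl -!lnXn ?g0// -!gX.
  have mj : (0 < m ^ j)%N by rewrite expn_gt0 m0.
  rewrite !ler_ln ?posrE ?g0 ?mj ?(expn_gt0 2)// !g_homo ?trunc_logP//.
  exact/ltnW/trunc_log_ltn.
pose L n : R := ln n%:R; pose G n := ln (f n).
have L2 : 0 < L 2%N by rewrite ln_gt0// ltr1n.
have f_ge1 n : (0 < n)%N -> 1 <= f n by move=> n0; rewrite -f1 f_homo.
have f_gt0 n : (0 < n)%N -> 0 < f n by move=> /f_ge1; exact: lt_le_trans.
have G2 : 0 <= G 2%N by rewrite ln_ge0// f_ge1.
have proportional m : (0 < m)%N -> G m * L 2%N = G 2%N * L m.
  move=> m0; apply/eqP; rewrite -subr_eq0; set D := _ - _.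
  (* The error is at most one step whatever [j] is, so [D] vanishes. Cross-multiplying avoids
     dividing by [G 2], which may be zero. *)
  have jD j : j%:R * `|D| <= G 2%N * L 2%N.
    have /andP[Gl Gu] := log_bounds f m j f1 fM f_homo m0.
    have /andP[Ll Lu] := log_bounds (fun n => n%:R) m j erefl (@natrM R)
      (fun k l => etrans (ler_nat R k l)) m0.
    move: Gl Gu Ll Lu; rewrite -!/(G _) -!/(L _) -natr1.
    set l := (trunc_log 2 _)%:R => Gl Gu Ll Lu.
    rewrite -[j%:R]ger0_norm// -normrM ler_norml /D.
    have := ler_wpM2r (ltW L2) Gl; have := ler_wpM2r (ltW L2) Gu.
    have := ler_wpM2l G2 Ll; have := ler_wpM2l G2 Lu.
    by move=> H1 H2 H3 H4; apply/andP; split; lra.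
  apply/negPn/negP; rewrite -normr_gt0 => D0.
  have := archi_boundP (divr_ge0 (mulr_ge0 G2 (ltW L2)) (normr_ge0 D)).
  by rewrite ltr_pdivrMr// ltNge jD.
exists (G 2%N / L 2%N).
  by rewrite divr_ge0 ?(ltW L2)//= ler_pdivrMr// mul1r ler_ln ?posrE ?f_gt0.
move=> n n0; rewrite /powR pnatr_eq0 gtn_eqF// mulrAC -proportional//.
by rewrite mulfK ?gt_eqF// lnK ?posrE ?f_gt0.
Qed.

Theorem theorem1p1 (R : realType)
    (phi : nat -> nat * nat) (phi_bij : bijective phi)
    (N : c00 R -> R) (N_norm : is_norm N)
    (N_perm : permutation_invariant N)
    (N_mult : multiplicative phi_bij N) :
  exists2 p : \bar R, (1 <= p)%E & forall x : c00 R, N x = lp_norm p x.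
Proof.
have hN := norm_seminorm N_norm N_perm N_mult.
have [_ N0 _ _] := N_norm; have Nind := norm_indicator N_perm.
pose f n := N (indicator R (iota 0 n)).
have fM : {morph f : m n / (m * n)%N >-> m * n}.
  move=> m n; rewrite /f -N_mult; have [psi phiK psiK] := phi_bij.
  (* Through [psi], the product of two initial segments becomes a list of [m * n] indices, the
     support of the tensor product. *)
  pose s := [seq psi (i, j) | i <- iota 0 m, j <- iota 0 n].
  have us : uniq s.
    apply: allpairs_uniq; rewrite ?iota_uniq// => -[i j] [i' j'] _ _ /=.
    by move=> /(can_inj psiK)[-> ->].
  have -> : (m * n)%N = size s by rewrite size_allpairs !size_iota.
  rewrite -Nind//; congr N; apply: c00_ext => i /=.
  rewrite -natrM mulnb; congr (nat_of_bool _)%:R.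
  rewrite -{1}[i]phiK; case: (phi i) => k l /=.
  apply/allpairsP/andP => [[[k' l'] /= [km ln /(can_inj psiK)[-> ->]]]|[km ln]].
    by [].
  by exists (k, l).
have f1 : f 1%N = 1.
  have f1_neq0 : f 1%N != 0.
    apply/eqP => /N0 /(congr1 (fun x : c00 R => x 0%N)) /= /eqP.
    by rewrite oner_eq0.
  by apply: (mulfI f1_neq0); rewrite -fM mulr1.
have f2 : f 2%N <= 2.
  have -> : 2 = f 1%N + N (indicator R [:: 1%N]) by rewrite Nind//= -/(f 1%N) f1.
  apply: le_trans (ts_triangle hN _ _); rewrite le_eqVlt; apply/orP; left.
  apply/eqP; congr N; apply: c00_ext => i.
  rewrite [RHS](_ : _ = (i \in [:: 0%N])%:R + (i \in [:: 1%N])%:R)//= !inE.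
  by case: i => [|[|i]]; rewrite /= ?addr0 ?add0r.
have f_homo : {homo f : m n / (m <= n)%N >-> m <= n}.
  move=> m n mn; rewrite /f.
  have -> : indicator R (iota 0 m) =
      restriction (fun i => i < m)%N (indicator R (iota 0 n)).
    apply: c00_ext => i; rewrite /= !mem_iota /= !add0n -natrM mulnb.
    by congr (nat_of_bool _)%:R; lia.
  exact: (ts_restriction hN).
have [a /andP[a0 a1] fa] := monotone_multiplicative_power f1 f2 fM f_homo.
(* The empty list is set apart because [fa] needs a positive length: for [a = 0] the power of 0
   would be 1, while [N 0 = 0]. *)
suff [p p1 pind] : exists2 p : \bar R, (1 <= p)%E &
    forall s, s != [::] -> uniq s ->
      N (indicator R s) = lp_norm p (indicator R s).
  have hp := lp_norm_seminorm phi_bij p1; exists p => // x.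
  have {}pind s : uniq s -> N (indicator R s) = lp_norm p (indicator R s).
    have [-> _|/pind//] := eqVneq s [::].
    have -> : indicator R [::] = 0 by exact: c00_ext.
    by rewrite (ts0 hN) (ts0 hp).
  apply/eqP; rewrite eq_le (ts_le hN hp)//= (ts_le hp hN)// => s us.
  by rewrite pind.
(* For [a = 0] all nonempty indicators have norm 1, as for the sup norm; otherwise [p = 1/a], at
   least 1 since [a <= 1]. *)
have [a_eq0|a_neq0] := eqVneq a 0.
  exists +oo%E => [|[//|i s] _ us]; first exact: leey.
  rewrite (@lp_norm_indicator_infty _ i) ?mem_head// Nind// -/(f _) fa//.
  by rewrite a_eq0 powRr0.
have a_gt0 : 0 < a by rewrite lt_neqAle eq_sym a_neq0.
exists a^-1%:E; first by rewrite lee_fin -invr1 lef_pV2 ?posrE.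
move=> s s0 us; rewrite lp_norm_indicator_fin ?invr_gt0// invrK Nind// -/(f _).
by rewrite fa// lt0n size_eq0.
Qed.
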